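(* Let $d\ge2$. There exists a constant $C>0$ depending only on $d$ such that for every $N\ge 3$, every $\omega:S_N\to(0,\infty)$ and every $\epsilon>0$, $$\tau^{\omega,N}\ \le\ C\,(\ell_\epsilon+1)^{2d}\left(N^{2+\epsilon}+\max_{x\in S_N}\frac1{\omega(x)}\right),$$ where $\tau^{\omega,N}$ is the inverse spectral gap of the random walk on the torus $S_N$ with jump rates $\omega(x)\wedge\omega(y)$, and $\ell_\epsilon=\ell_\epsilon(\omega,N)\in\{1,2,\dots\}\cup\{\infty\}$ is the smallest width of strips for which all strips are crossed lengthwise by $\epsilon$-good sites, both as defined in the context. (If $\ell_\epsilon=\infty$ the right-hand side is $+\infty$.)
   Context: Torus and spectral gap. $S_N=(\mathbb Z/N\mathbb Z)^d$ is the discrete torus with nearest neighbor relation $\sim$, $a\wedge b=\min(a,b)$, $\eta_N(f)=N^{-d}\sum_{x\in S_N}f(x)$, $$\mathcal E^{\omega,N}(f,f)=\frac1{2N^d}\sum_{x,y\in S_N:\,x\sim y}(\omega(x)\wedge\omega(y))(f(x)-f(y))^2,\qquad \tau^{\omega,N}=\sup_{f\not\equiv0,\ \eta_N(f)=0}\frac{\eta_N(f^2)}{\mathcal E^{\omega,N}(f,f)}.$$ Good sites. A site $x\in S_N$ is $\epsilon$-good if $\omega(x)>N^{-\epsilon}$, otherwise $\epsilon$-bad. Base paths. For $x\ne y$ in $S_N$, let $i_1<\dots<i_k$ ($1\le k\le d$) be the coordinates in which $x$ and $y$ differ. The path $\eta_{x,y}$ from $x$ to $y$ changes coordinates $i_1,\dots,i_k$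 in this order, one unit step at a time, each coordinate being moved from its value in $x$ to its value in $y$ along the longer of the two arcs of the cycle $\mathbb Z/N\mathbb Z$ (ties resolved by a fixed deterministic rule). Thus $\eta_{x,y}$ is the concatenation of segments $\gamma_1,\dots,\gamma_k$, each of length at least $N/2$, with $\gamma_j$ parallel to the unit vector $e_{i_j}$; let $\sigma_j\in\{+1,-1\}$ be the sign of the direction in which $\gamma_j$ is traversed. Strips. Let $L\ge1$ be an integer with $3L<N$. Given a path $p$ in $S_N$ and a signed unit vector $v=\pm e_i$ such that the $i$-th coordinate is constant along $p$, the strip with base $p$, direction $v$ and width $L$ is $\{p_m+l v:\ 0\le m\le|p|,\ 0\le l\le L-1\}$ (coordinates mod $N$), regarded as a two-dimensional rectangle with coordinates $(m,l)$ and the usual nearest neighbor adjacency in $(m,l)$; its two smaller sides are the sets $m=0$ and $m=|p|$. The strips involved in the sausage of $(x,y)$ are: (1) if $k<d$: the single strip with base $\eta_{x,y}$ and direction $e_{i^*}$, where $i^*$ is the smallest element of $\{1,\dots,d\}\setminus\{i_1,\dots,i_k\}$; (2) if $k=d$: two strips, namely $R_1$ with base $\gamma_1$ and direction $\sigma_2e_2$, and the strip with base $\gamma_2\cup\dots\cup\gamma_d$ and direction $-\sigma_1e_1$ (so that the two strips overlap in an $L\times L$ square at the corner where $\gamma_1$ meets $\gamma_2$). Crossing events. For a strip $\mathcal S$ of width $L$, $A_{\mathcal S}$ is the event (property of $\omega$) that there is a nearest neighbor path of $\epsilon$-good sites within $\mathcal S$ connecting its two smaller sides. $A_N(L)$ is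 the event that $A_{\mathcal S}$ holds for all strips $\mathcal S$ of width $L$ involved in the sausages of all pairs $x\neq y$ in $S_N$. Finally $$\ell_\epsilon=\inf\{L\ge1 \text{ integer}:\ 3L<N \text{ and } A_N(L)\text{ occurs}\},\qquad \inf\emptyset=\infty.$$ *)

(* Defs.v *)
From HB Require Import structures.
From mathcomp Require Import all_boot all_order all_algebra.
From mathcomp Require Import all_classical all_reals all_analysis.

Set Implicit Arguments.
Unset Strict Implicit.
Unset Printing Implicit Defensive.

Import Order.TTheory GRing.Theory Num.Theory.

Local Open Scope ring_scope.

(* 'Z_N is Z/NZ only for N >= 2. *)
Notation torus d N := 'rV['Z_N]_d.

Definition unit_vec (d N : nat) (i : 'I_d) : torus d N := delta_mx 0 i.

(* A sign is a boolean, true standing for +1. *)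
Definition signed_vec (d N : nat) (b : bool) (i : 'I_d) : torus d N :=
  if b then unit_vec N i else - unit_vec N i.

Definition nearest_neighbor (d N : nat) : rel (torus d N) :=
  fun x y => [exists i, exists b, y == x + signed_vec N b i].

Section SpectralGap.
Context {R : realType} {d N : nat}.
Implicit Types (omega f : torus d N -> R).

Definition torus_mean f : R := (N%:R ^+ d)^-1 * \sum_(x : torus d N) f x.

Definition dirichlet_form omega f : R :=
  (2 * N%:R ^+ d)^-1 *
  \sum_(x : torus d N) \sum_(y : torus d N | nearest_neighbor x y)
    Num.min (omega x) (omega y) * (f x - f y) ^+ 2.

Definition inverse_spectral_gap omega : \bar R :=
  ereal_sup [set t | exists f, [/\ exists x, f x != 0, torus_mean f = 0 &
    t = (torus_mean (fun x => f x ^+ 2) / dirichlet_form omega f)%:E]].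

Definition good (eps : R) omega (x : torus d N) : Prop :=
  N%:R `^ (- eps) < omega x.

End SpectralGap.

(* A rule for choosing the direction of travel when the two arcs have the same
   length: [tie x y i] is true when the path from x to y is to move its
   coordinate i in the positive direction. *)
Definition tie_rule (d N : nat) : Type :=
  torus d N -> torus d N -> 'I_d -> bool.

Section BasePaths.
Context {d N : nat} (tie : tie_rule d N).
Implicit Types (x y : torus d N) (i : 'I_d).

(* Representatives in {0, ..., N - 1}: the numbers of +1 steps and of -1 steps
   leading from x_i to y_i. *)
Definition arc_pos x y i : nat := (y 0 i - x 0 i)%R.
Definition arc_neg x y i : nat := (x 0 i - y 0 i)%R.

Definition arc_sign x y i : bool :=
  if arc_pos x y i == arc_neg x y i then tie x y i
  else (arc_neg x y i < arc_pos x y i)%N.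

Definition arc_length x y i : nat := maxn (arc_pos x y i) (arc_neg x y i).

(* The site at which all coordinates before i have been changed and coordinate
   i has not: the starting point of the segment parallel to e_i. *)
Definition corner x y i : torus d N :=
  \row_j (if (j < i)%N then y 0 j else x 0 j).

(* The segment parallel to e_i, without its starting point. *)
Definition segment_steps x y i : seq (torus d N) :=
  [seq corner x y i + signed_vec N (arc_sign x y i) i *+ m
     | m <- iota 1 (arc_length x y i)].

(* The concatenation, from z = the start of the first segment, of the segments
   parallel to the e_i for i in s. *)
Definition concat_segments x y (z : torus d N) (s : seq 'I_d) :
    seq (torus d N) :=
  z :: flatten [seq segment_steps x y i | i <- s].

(* [enum 'I_d] is increasing, so the coordinates are changed in order. *)
Definition base_path x y : seq (torus d N) :=
  concat_segments x y x [seq i <- enum 'I_d | x 0 i != y 0 i].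

End BasePaths.

(* A path p_0, ..., p_n is the list of its n + 1 sites, so |p| is the
   predecessor of the size of the list. A strip is the pair (base, direction). *)
Definition strip (d N : nat) : eqType := (seq (torus d N) * torus d N)%type.

Definition strip_base (d N : nat) (S : strip d N) : seq (torus d N) := S.1.
Definition strip_dir (d N : nat) (S : strip d N) : torus d N := S.2.

Definition strip_length (d N : nat) (S : strip d N) : nat :=
  (size (strip_base S)).-1.

Definition strip_site (d N : nat) (S : strip d N) (c : nat * nat) : torus d N :=
  nth 0 (strip_base S) c.1 + strip_dir S *+ c.2.

(* If no coordinate of x and y agrees then the coordinates 1 and 2 are the
   first two elements i1, i2 of [enum 'I_d]; the last branch occurs only for
   d < 2. *)
Definition sausage_strips (d N : nat) (tie : tie_rule d N)
    (x y : torus d N) : seq (strip d N) :=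
  match [seq i <- enum 'I_d | x 0 i == y 0 i], enum 'I_d with
  | istar :: _, _ => [:: (base_path tie x y, unit_vec N istar)]
  | [::], i1 :: i2 :: s =>
      [:: (concat_segments tie x y x [:: i1],
           signed_vec N (arc_sign tie x y i2) i2);
          (concat_segments tie x y (corner x y i2) (i2 :: s),
           - signed_vec N (arc_sign tie x y i1) i1)]
  | _, _ => [::]
  end.

Definition rect_adj : rel (nat * nat) := fun a b =>
  (a.1 == b.1) && ((a.2 == b.2.+1) || (b.2 == a.2.+1)) ||
  (a.2 == b.2) && ((a.1 == b.1.+1) || (b.1 == a.1.+1)).

Section Crossings.
Context {R : realType} {d N : nat}.
Variables (tie : tie_rule d N) (eps : R) (omega : torus d N -> R).

Definition strip_crossed (L : nat) (S : strip d N) : Prop :=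
  exists (c : nat * nat) (s : seq (nat * nat)),
    [/\ path rect_adj c s, c.1 = 0%N, (last c s).1 = strip_length S &
        forall a, a \in c :: s ->
          [/\ (a.1 <= strip_length S)%N, (a.2 < L)%N &
              good eps omega (strip_site S a)]].

Definition all_crossed (L : nat) : Prop :=
  forall (x y : torus d N), x != y ->
  forall S, S \in sausage_strips tie x y -> strip_crossed L S.

Definition ell : \bar R :=
  ereal_inf [set t | exists L : nat,
    [/\ (1 <= L)%N, (3 * L < N)%N, all_crossed L & t = (L%:R)%:E]].

End Crossings.

(* Main.v *)
(* For f of mean zero, eta_N(f^2) is a multiple of sum_(x, y) (f x - f y)^2.
   Passing from x to y one coordinate at a time reduces this double sum to pairs
   x, y that differ in a single coordinate; for these the sausage is one
   straight strip, so the crossings of two overlapping strips at a corner never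
   have to be matched.  Connect x to the start of the crossing of that strip,
   follow the crossing, and go from its end to y.  The two end pieces have at
   most L edges of conductance at least min omega, the crossing at most N L
   edges of conductance at least N^-eps.  Cauchy-Schwarz along the three pieces,
   together with translation invariance of the sum over x, gives
   eta_N(f^2) <= 6 d^3 L^2 (N^(2 + eps) + max 1/omega) E(f, f). *)
Require Import Defs.
From HB Require Import structures.
From mathcomp Require Import all_boot all_order all_algebra.
From mathcomp Require Import all_classical all_reals all_analysis.
From mathcomp Require Import ring lra.

Set Implicit Arguments.
Unset Strict Implicit.
Unset Printing Implicit Defensive.

Import Order.TTheory GRing.Theory Num.Theory.

Local Open Scope ring_scope.

(** * Cauchy-Schwarz for sums, telescopes and paths *)

Section FiniteSums.
Variable R : realFieldType.

Lemma sumr_constl (T : finType) (c : R) : \sum_(x : T) c = #|T|%:R * c.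
Proof. by rewrite sumr_const mulr_natl. Qed.

Lemma sum_sqr_diff (T : finType) (F : T -> R) :
  \sum_x \sum_y (F x - F y) ^+ 2 =
    2 * (#|T|%:R * \sum_x F x ^+ 2 - (\sum_x F x) ^+ 2).
Proof.
transitivity (\sum_x \sum_y (F x ^+ 2 + F y ^+ 2 - 2 * (F x * F y))).
  by apply: eq_bigr => x _; apply: eq_bigr => y _; ring.
under eq_bigr => x _.
  rewrite sumrB big_split /= sumr_constl -!mulr_sumr.
  over.
rewrite sumrB big_split /= sumr_constl -!mulr_sumr -mulr_suml.
by ring.
Qed.

Lemma sqr_sum_le (n : nat) (F : nat -> R) :
  (\sum_(0 <= k < n) F k) ^+ 2 <= n%:R * \sum_(0 <= k < n) F k ^+ 2.
Proof.
rewrite !big_mkord; have := sum_sqr_diff (fun k : 'I_n => F k); rewrite card_ord => E.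
have : 0 <= \sum_(x < n) \sum_(y < n) (F x - F y) ^+ 2.
  by do 2! (apply: sumr_ge0 => ? _); apply: sqr_ge0.
by rewrite {}E pmulr_rge0 // subr_ge0.
Qed.

Lemma sqr_telescope_le (n : nat) (h : nat -> R) :
  (h 0%N - h n) ^+ 2 <= n%:R * \sum_(0 <= k < n) (h k - h k.+1) ^+ 2.
Proof.
rewrite -sqrrN opprB -telescope_sumr //.
by under [X in _ <= _ * X]eq_bigr => k _ do rewrite -sqrrN opprB; apply: sqr_sum_le.
Qed.

Lemma ler_sum_subseq (T : eqType) (s t : seq T) (E : T -> R) :
  (forall a, 0 <= E a) -> uniq s -> uniq t -> {subset s <= t} ->
  \sum_(a <- s) E a <= \sum_(a <- t) E a.
Proof.
move=> E0 us ut st; rewrite -(perm_big _ (permEl (perm_filterC (mem s) t))) big_cat /=.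
have /(perm_big _) -> : perm_eq s [seq x <- t | mem s x].
  apply: uniq_perm => [||a] //; first exact: filter_uniq.
  rewrite mem_filter /=.
  by case: (boolP (a \in s)) => //= /st.
by rewrite lerDl sumr_ge0.
Qed.

(** Each step is charged to the site it leaves; the last site starts no step and only adds a
    nonnegative surplus. *)
Lemma path_energy (T : eqType) (e : rel T) (c : T) (s : seq T) (h E : T -> R) :
  (forall a, 0 <= E a) -> path e c s ->
  (forall a b, a \in c :: s -> b \in c :: s -> e a b -> (h a - h b) ^+ 2 <= E a) ->
  (h c - h (last c s)) ^+ 2 <= (size s)%:R * \sum_(a <- c :: s) E a.
Proof.
move=> E0 /(pathP c) p H.
have -> : last c s = nth c (c :: s) (size s) by rewrite -[size s]/(size (c :: s)).-1 nth_last.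
apply: le_trans (sqr_telescope_le _ (fun k => h (nth c (c :: s) k))) _.
rewrite ler_wpM2l // (big_nth c) /= big_nat_recr //= ler_wpDr //.
rewrite big_nat [leRHS]big_nat ler_sum // => k /andP[_ ks].
by apply: H; [rewrite mem_nth //= ltnS ltnW | rewrite inE mem_nth ?orbT | exact: p].
Qed.

Lemma sqr_add3_le (a b c : R) : (a + b + c) ^+ 2 <= 3 * (a ^+ 2 + b ^+ 2 + c ^+ 2).
Proof.
have := sqr_ge0 (a - b); have := sqr_ge0 (b - c); have := sqr_ge0 (a - c).
by rewrite !expr2; nra.
Qed.

End FiniteSums.

(** * Reduction to pairs that differ in one coordinate *)

Section Mixing.
Variables (R : realFieldType) (A : finType) (d : nat).
Implicit Types x y : 'rV[A]_d.

Definition mix (P : pred 'I_d) x y : 'rV[A]_d :=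
  \row_j (if P j then y 0 j else x 0 j).

Lemma mixK (P : pred 'I_d) x y : mix P (mix P x y) (mix P y x) = x.
Proof. by apply/rowP => j; rewrite !mxE; case: (P j). Qed.

(* (x, y) |-> (mix P x y, mix P y x) is an involution. *)
Lemma sum_mix (P : pred 'I_d) (F : 'rV[A]_d -> 'rV[A]_d -> R) :
  \sum_x \sum_y F (mix P x y) (mix P y x) = \sum_x \sum_y F x y.
Proof.
have K : involutive (fun p : 'rV[A]_d * 'rV[A]_d => (mix P p.1 p.2, mix P p.2 p.1)).
  by move=> [x y] /=; rewrite !mixK.
rewrite !pair_bigA /=; symmetry; exact: (reindex_inj (inv_inj K)).
Qed.

(** Telescope along the hybrids that pass from [x] to [y] one coordinate at a time. Swapping
    coordinates preserves the sum over all pairs, so each hybrid step can be summed as a step from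
    an arbitrary pair. *)
Lemma sum_sqr_diff_coord (f : 'rV[A]_d -> R) :
  \sum_x \sum_y (f x - f y) ^+ 2 <=
    d%:R * \sum_(i < d) \sum_x \sum_y (f x - f (mix (pred1 i) x y)) ^+ 2.
Proof.
pose hyb k x y := mix (fun j : 'I_d => (j < k)%N) x y.
apply: (@le_trans _ _ (\sum_x \sum_y d%:R * \sum_(i < d)
    (f (hyb i x y) - f (mix (pred1 i) (hyb i x y) (hyb i y x))) ^+ 2)).
  apply: ler_sum => x _; apply: ler_sum => y _.
  have -> : f x - f y = f (hyb 0%N x y) - f (hyb d x y).
    by congr (f _ - f _); apply/rowP => j; rewrite !mxE // ltn_ord.
  apply: le_trans (sqr_telescope_le d (fun k => f (hyb k x y))) _.
  rewrite big_mkord ler_wpM2l // ler_sum // => i _.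
  (* Only coordinate [i] changes, to [y 0 i], which [hyb i y x] still carries; the step depends on
     the swapped pair alone, as [sum_mix] requires. *)
  suff -> : hyb i.+1 x y = mix (pred1 i) (hyb i x y) (hyb i y x) by [].
  apply/rowP => j; rewrite !mxE /= ltnS leq_eqVlt -val_eqE /=.
  by case: (ltngtP j i).
under eq_bigr => x _ do rewrite -mulr_sumr exchange_big /=.
rewrite -mulr_sumr exchange_big /= ler_wpM2l // ler_sum // => i _.
by rewrite (sum_mix _ (fun u v => (f u - f (mix (pred1 i) u v)) ^+ 2)).
Qed.

End Mixing.

(** * Straight strips in the torus *)

Section Torus.
Variables (R : realType) (d N : nat).
Hypothesis N_gt1 : (1 < N)%N.
Implicit Types (x y u : torus d N) (f omega : torus d N -> R) (i j : 'I_d).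

Lemma card_torus : #|{: torus d N}| = (N ^ d)%N.
Proof. by rewrite card_mx card_ord Zp_cast // mul1n. Qed.

Lemma signed_vecN b i : signed_vec N (~~ b) i = - signed_vec N b i.
Proof. by case: b; rewrite /signed_vec //= opprK. Qed.

Lemma nearest_neighborD x b i : nearest_neighbor x (x + signed_vec N b i).
Proof. by apply/existsP; exists i; apply/existsP; exists b. Qed.

Lemma nearest_neighborB x b i : nearest_neighbor (x + signed_vec N b i) x.
Proof. by rewrite -{2}[x](addrK (signed_vec N b i)) -signed_vecN nearest_neighborD. Qed.

(** Rectangle coordinates of a straight strip, written as a translate of [x] so that a sum over [x]
    does not see them. *)
Definition grid_site x b i j (a : nat * nat) : torus d N :=
  x + signed_vec N b i *+ a.1 + unit_vec N j *+ a.2.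

Lemma rect_adj_neighbor x b i j (a c : nat * nat) :
  rect_adj a c -> nearest_neighbor (grid_site x b i j a) (grid_site x b i j c).
Proof.
case: a c => [a1 a2] [c1 c2]; rewrite /rect_adj /grid_site /=.
case/orP => /andP[/eqP -> /orP[] /eqP ->]; rewrite mulrSr ?addrA.
- exact: (nearest_neighborB _ true).
- exact: (nearest_neighborD _ true).
- by rewrite (addrAC _ (signed_vec N b i) (unit_vec N j *+ _)) nearest_neighborB.
- by rewrite (addrAC _ (signed_vec N b i) (unit_vec N j *+ _)) nearest_neighborD.
Qed.

(** Edge energies are assigned to their first site; the sum over [x] is [2 * N%:R ^+ d] times the
    Dirichlet form. *)
Definition site_energy omega f x : R :=
  \sum_(y | nearest_neighbor x y) Num.min (omega x) (omega y) * (f x - f y) ^+ 2.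

(** The base path is one segment along an arc of length [n], and for d >= 2 some coordinate [j]
    stays fixed, so the single-strip case applies. *)
Lemma one_coord_strip (tie : tie_rule d N) x y i :
  x 0 i != y 0 i -> (forall j, j != i -> x 0 j = y 0 j) -> (1 < d)%N ->
  exists b n j, [/\ (n < N)%N, y = x + signed_vec N b i *+ n &
    sausage_strips tie x y =
      [:: ([seq x + signed_vec N b i *+ m | m <- iota 0 n.+1], unit_vec N j)]].
Proof.
move=> xy_i xy_j d_gt1; exists (arc_sign tie x y i), (arc_length x y i).
have Ez : (Zp_trunc N).+2 = N by rewrite Zp_cast.
have y_end : y = x + signed_vec N (arc_sign tie x y i) i *+ arc_length x y i.
  apply/rowP => k; rewrite mxE mulmxnE.
  have [->|ki] := eqVneq k i; last first.
    rewrite /signed_vec /unit_vec -xy_j //.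
    by case: ifP => _; rewrite !mxE (negPf ki) andbF ?oppr0 mul0rn addr0.
  have Ep : (arc_pos x y i)%:R = y 0 i - x 0 i by rewrite natr_Zp.
  have En : (arc_neg x y i)%:R = x 0 i - y 0 i by rewrite natr_Zp.
  (* In a tie both arcs have the same length, so either value of [tie] fits. *)
  have : if arc_sign tie x y i then arc_length x y i = arc_pos x y i
         else arc_length x y i = arc_neg x y i.
    rewrite /arc_sign /arc_length; by case: ltngtP => // ->; case: ifP.
  rewrite /signed_vec /unit_vec.
  by case: ifP => _ ->; rewrite !mxE !eqxx ?mulNrn ?Ep ?En; ring.
have base : base_path tie x y =
    [seq x + signed_vec N (arc_sign tie x y i) i *+ m | m <- iota 0 (arc_length x y i).+1].
  rewrite /base_path; have -> : [seq k <- enum 'I_d | x 0 k != y 0 k] = [:: i].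
    rewrite -[RHS](filter_pred1_uniq (enum_uniq 'I_d)) ?mem_enum //.
    apply: eq_filter => k /=; have [->//|ki] := eqVneq k i.
    by rewrite xy_j // eqxx.
  rewrite /concat_segments /segment_steps /= cats0 mulr0n addr0; congr (_ :: _).
  suff -> : corner x y i = x by [].
  by apply/rowP => k; rewrite !mxE; case: ltnP => // ki; rewrite xy_j // -val_eqE /= ltn_eqF.
have : exists j, j \in [seq k <- enum 'I_d | x 0 k == y 0 k].
  have [j ji] : exists j, j != i.
    have d_gt0 := ltnW d_gt1.
    have [i0|i0] := eqVneq (val i) 0%N.
      by exists (Ordinal d_gt1); rewrite -val_eqE /= i0.
    by exists (Ordinal d_gt0); rewrite -val_eqE eq_sym.
  by exists j; rewrite mem_filter xy_j // eqxx mem_enum.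
rewrite /sausage_strips base; case: [seq _ <- _ | _] => [[j]|j s _]; first by rewrite in_nil.
exists j; split=> //.
by rewrite /arc_length gtn_max -{2}Ez -{4}Ez !ltn_ord.
Qed.

(** * Energy bounds along strips and their sums over the torus *)

Section Energy.
Variables (omega f : torus d N -> R).
Hypothesis omega_gt0 : forall x, 0 < omega x.
Local Notation E := (site_energy omega f).

Lemma site_energy_ge0 x : 0 <= E x.
Proof.
by apply: sumr_ge0 => y _; rewrite mulr_ge0 ?sqr_ge0 // le_min !ltW.
Qed.

Lemma edge_energy_le (c : R) x y : 0 < c -> c^-1 <= omega x -> c^-1 <= omega y ->
  nearest_neighbor x y -> (f x - f y) ^+ 2 <= c * E x.
Proof.
move=> c0 cx cy xy; rewrite -ler_pdivrMl //.
rewrite /site_energy (bigD1 y) //= ler_wpDr //.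
  by apply: sumr_ge0 => z _; rewrite mulr_ge0 ?sqr_ge0 // le_min !ltW.
by rewrite ler_wpM2r ?sqr_ge0 // le_min cx.
Qed.

Local Notation M := (\big[Num.max/0]_x (omega x)^-1).

(** Every edge has conductance at least [M^-1]. The sum is extended to [L] sites to remove its
    dependence on [l]. *)
Lemma segment_energy_le x j (L l : nat) : (l < L)%N ->
  (f x - f (x + unit_vec N j *+ l)) ^+ 2 <=
    L%:R * (M * \sum_(0 <= k < L) E (x + unit_vec N j *+ k)).
Proof.
move=> lL; have V z : (omega z)^-1 <= M by exact: le_bigmax.
have M0 : 0 < M by apply: lt_le_trans (V x); rewrite invr_gt0.
have Mz z : M^-1 <= omega z by rewrite -[leRHS]invrK lef_pV2 ?V // posrE ?invr_gt0.
rewrite -{1}[x]addr0 -(mulr0n (unit_vec N j)).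
apply: le_trans (sqr_telescope_le _ (fun k => f (x + unit_vec N j *+ k))) _.
apply: ler_pM; rewrite ?ler_nat ?(ltnW lL) //.
  by apply: sumr_ge0 => ? _; apply: sqr_ge0.
rewrite (big_cat_nat (leq0n l) (ltnW lL)) /= mulrDr ler_wpDr //.
  by rewrite mulr_ge0 ?(ltW M0) // sumr_ge0 // => k _; apply: site_energy_ge0.
rewrite mulr_sumr; apply: ler_sum => k _; apply: edge_energy_le => //.
by rewrite mulrSr addrA (nearest_neighborD _ true).
Qed.

Lemma crossing_energy_le (eps : R) x b i j (n L : nat) : (n < N)%N ->
  strip_crossed eps omega L
    ([seq x + signed_vec N b i *+ m | m <- iota 0 n.+1], unit_vec N j) ->
  exists l l' : nat, [/\ (l < L)%N, (l' < L)%N &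
    (f (grid_site x b i j (0%N, l)) - f (grid_site x b i j (n, l'))) ^+ 2 <=
    (N * L)%:R * (N%:R `^ eps *
      \sum_(0 <= m < N) \sum_(0 <= l < L) E (grid_site x b i j (m, l)))].
Proof.
move=> nN [c [s [cs c0]]]; rewrite /strip_length /strip_base /= size_map size_iota /=.
(* A crossing without repetitions has at most [N * L] sites and charges each rectangle site at most
   once. *)
case: (shortenP cs) => t ct uct sub_ts end_t H.
have {}H a : a \in c :: t ->
    [/\ (a.1 <= n)%N, (a.2 < L)%N & good eps omega (grid_site x b i j a)].
  move=> a_ct; have /H[an aL] : a \in c :: s.
    by move: a_ct; rewrite !inE => /orP[->//|/sub_ts ->]; rewrite orbT.
  have a_nth : nth 0 [seq x + signed_vec N b i *+ m | m <- iota 0 n.+1] a.1 =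
      x + signed_vec N b i *+ a.1 by rewrite (nth_map 0%N) ?size_iota ?nth_iota.
  by move=> g; split=> //; rewrite /grid_site -a_nth; exact: g.
have [_ c2 _] := H c (mem_head _ _).
have [_ t2 _] := H _ (mem_last c t).
exists c.2, (last c t).2; split=> //.
have -> : (0%N, c.2) = c by rewrite -c0; case: (c).
have -> : (n, (last c t).2) = last c t by rewrite -end_t; case: (last c t).
have P0 : 0 < N%:R `^ eps :> R by rewrite powR_gt0 // ltr0n ltnW.
(* Since [n < N], the [n.+1] columns of the strip fit into [N] columns, a number independent of the
   pair. *)
have sub : {subset c :: t <= [seq (m, l) | m <- index_iota 0 N, l <- index_iota 0 L]}.
  move=> [m l] /H[/= mn lL _]; apply/allpairsP; exists (m, l).
  by rewrite !mem_index_iota /= (leq_ltn_trans mn nN).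
apply: le_trans (path_energy (h := fun a => f (grid_site x b i j a))
  (E := fun a => N%:R `^ eps * E (grid_site x b i j a)) _ ct _) _.
- by move=> a; rewrite mulr_ge0 ?site_energy_ge0 // ltW.
- move=> a a' /H[_ _ ga] /H[_ _ ga'] /(rect_adj_neighbor x b i j) nn.
  by apply: edge_energy_le; rewrite // -powRN ltW.
rewrite -mulr_sumr; apply: ler_pM => //.
- by rewrite mulr_ge0 ?(ltW P0) // sumr_ge0 // => a _; apply: site_energy_ge0.
- rewrite ler_nat; have := uniq_leq_size uct sub.
  by rewrite size_allpairs !size_iota !subn0 /=; apply: leq_trans.
rewrite ler_wpM2l ?(ltW P0) //.
rewrite -(big_allpairs (F := fun a => E (grid_site x b i j a))).
apply: ler_sum_subseq => // [a|]; first exact: site_energy_ge0.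
by apply: allpairs_uniq; rewrite ?iota_uniq // => -[? ?] [? ?] _ _ [-> ->].
Qed.

(** The sum over all [j], and in [grid_energy] also over both signs, dominates whichever strip the
    pair selects, so the bound depends on the starting site only. *)
Definition cross_energy (L : nat) x : R :=
  \sum_j \sum_(0 <= l < L) E (x + unit_vec N j *+ l).

Definition grid_energy (L : nat) i x : R :=
  \sum_j \sum_b \sum_(0 <= m < N) \sum_(0 <= l < L) E (grid_site x b i j (m, l)).

Lemma pair_energy_le (tie : tie_rule d N) (eps : R) (L : nat) x u i :
  (1 < d)%N -> all_crossed tie eps omega L ->
  (f x - f (mix (pred1 i) x u)) ^+ 2 <=
    3 * (L%:R * (M * cross_energy L x)
         + (N * L)%:R * (N%:R `^ eps * grid_energy L i x)
         + L%:R * (M * cross_energy L (mix (pred1 i) x u))).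
Proof.
move=> d_gt1 cross; set y := mix _ _ _.
have V z : (omega z)^-1 <= M by exact: le_bigmax.
have M0 : 0 <= M by apply: le_trans (V x); rewrite invr_ge0 ltW.
have P0 : 0 <= N%:R `^ eps :> R by exact: powR_ge0.
have Cle z j : \sum_(0 <= l < L) E (z + unit_vec N j *+ l) <= cross_energy L z.
  rewrite /cross_energy (bigD1 j) //= lerDl.
  by do 2! (apply: sumr_ge0 => ? _); apply: site_energy_ge0.
have Gle b j : \sum_(0 <= m < N) \sum_(0 <= l < L) E (grid_site x b i j (m, l))
    <= grid_energy L i x.
  rewrite /grid_energy (bigD1 j) //= (bigD1 b) //= -addrA lerDl addr_ge0 //.
    by do 3! (apply: sumr_ge0 => ? _); apply: site_energy_ge0.
  by do 4! (apply: sumr_ge0 => ? _); apply: site_energy_ge0.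
have C0 z : 0 <= cross_energy L z.
  by do 2! (apply: sumr_ge0 => ? _); apply: site_energy_ge0.
have G0 : 0 <= grid_energy L i x.
  by do 4! (apply: sumr_ge0 => ? _); apply: site_energy_ge0.
(* If the coordinates [i] agree, the two sites coincide and the left side is 0; otherwise there is a
   strip to cross. *)
have [xy|xy] := eqVneq (x 0 i) (y 0 i).
  have -> : y = x.
    by apply/rowP => j; rewrite mxE /=; case: eqP => // ->; rewrite xy mxE /= eqxx.
  by rewrite subrr expr0n /= mulr_ge0 // !addr_ge0 ?mulr_ge0.
have yx j : j != i -> x 0 j = y 0 j by move=> ji; rewrite mxE /= (negPf ji).
have [b [n [j [nN y_end strips]]]] := one_coord_strip tie xy yx d_gt1.
have neq_xy : x != y by apply: contra_neq xy => ->.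
have := cross x y neq_xy; rewrite strips => /(_ _ (mem_head _ _)).
case/(crossing_energy_le nN) => l [l' [lL l'L]].
rewrite /grid_site /= mulr0n addr0 -y_end => mid.
have -> : f x - f y = (f x - f (x + unit_vec N j *+ l))
    + (f (x + unit_vec N j *+ l) - f (y + unit_vec N j *+ l'))
    - (f y - f (y + unit_vec N j *+ l')) by ring.
apply: le_trans (sqr_add3_le _ _ _) _; rewrite sqrrN ler_wpM2l //.
rewrite !lerD //.
- by apply: le_trans (segment_energy_le x j lL) _; rewrite !ler_wpM2l.
- by apply: le_trans mid _; rewrite !ler_wpM2l //; apply: Gle.
- by apply: le_trans (segment_energy_le y j l'L) _; rewrite !ler_wpM2l.
Qed.

Lemma sum_translate (g : torus d N -> R) u : \sum_x g (x + u) = \sum_x g x.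
Proof. by rewrite [RHS](reindex_inj (addIr u)). Qed.

Lemma sum_cross_energy (L : nat) :
  \sum_x cross_energy L x = d%:R * (L%:R * \sum_x E x).
Proof.
rewrite exchange_big /=.
under eq_bigr => j _.
  rewrite exchange_big /=; under eq_bigr => l _ do rewrite sum_translate.
  rewrite sumr_const_nat subn0 -mulr_natl; over.
by rewrite sumr_constl card_ord.
Qed.

(** The factors count [d] directions, two signs, [N] columns and [L] rows; each choice contributes a
    translate of the total energy. *)
Lemma sum_grid_energy (L : nat) i :
  \sum_x grid_energy L i x = d%:R * (2 * (N%:R * (L%:R * \sum_x E x))).
Proof.
rewrite exchange_big /=.
under eq_bigr => j _.
  rewrite exchange_big /=.
  under eq_bigr => b _.
    rewrite exchange_big /=.
    under eq_bigr => m _.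
      rewrite exchange_big /=.
      under eq_bigr => l _.
        rewrite /grid_site; under eq_bigr => x _ do rewrite -addrA; rewrite sum_translate; over.
      rewrite sumr_const_nat subn0 -[_ *+ L]mulr_natl; over.
    rewrite sumr_const_nat subn0 -[_ *+ N]mulr_natl; over.
  rewrite sumr_constl card_bool; over.
by rewrite sumr_constl card_ord.
Qed.

Lemma sum_sqr_diff_energy_le (tie : tie_rule d N) (eps : R) (L : nat) :
  (1 < d)%N -> all_crossed tie eps omega L ->
  \sum_x \sum_y (f x - f y) ^+ 2 <=
    6 * d%:R ^+ 3 * N%:R ^+ d * L%:R ^+ 2 * (N%:R `^ (2 + eps) + M) * \sum_x E x.
Proof.
move=> d_gt1 cross; apply: le_trans (sum_sqr_diff_coord f) _.
set D := \sum_x E x.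
(* The 6 is 3 from splitting into three pieces times 2: two end pieces in front of [M], two signs in
   front of the power of [N]. The inner [d%:R] counts the directions [j]. *)
apply: (@le_trans _ _ (d%:R * \sum_(i < d) (6 * d%:R * N%:R ^+ d * L%:R ^+ 2 *
    (N%:R `^ (2 + eps) + M) * D))); last first.
  rewrite sumr_constl card_ord le_eqVlt; apply/orP; left; apply/eqP.
  by move: (N%:R ^+ d) => Nd; ring.
rewrite ler_wpM2l // ler_sum // => i _.
apply: le_trans.
  by apply: ler_sum => x _; apply: ler_sum => u _; apply: (pair_energy_le x u i d_gt1 cross).
under eq_bigr => x _.
  rewrite -mulr_sumr !big_split /= !sumr_constl -!mulr_sumr.
  over.
rewrite -mulr_sumr !big_split /= -!mulr_sumr.
(* Swapping coordinate [i] turns the end point into the starting point, so both end pieces have the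
   same sum. *)
rewrite (sum_mix (pred1 i) (fun x _ => cross_energy L x)).
under [X in _ + _ * (_ * X)]eq_bigr => x _ do rewrite sumr_constl.
rewrite -!mulr_sumr sum_cross_energy sum_grid_energy -/D.
rewrite powRD; last by rewrite pnatr_eq0 -lt0n (ltnW N_gt1) implybT.
rewrite powR_mulrn // card_torus natrX natrM le_eqVlt; apply/orP; left; apply/eqP.
by move: (N%:R ^+ d) => Nd; ring.
Qed.

End Energy.
End Torus.

(** * From the double sum to the spectral gap and [ell] *)

Section Gap.
Variables (R : realType) (d N : nat) (omega : torus d N -> R).
Hypotheses (d_gt1 : (1 < d)%N) (N_gt1 : (1 < N)%N).
Hypothesis omega_gt0 : forall x, 0 < omega x.

Lemma inverse_spectral_gap_le (tie : tie_rule d N) (eps : R) (L : nat) :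
  all_crossed tie eps omega L ->
  (inverse_spectral_gap omega <=
    (6 * d%:R ^+ 3 * L%:R ^+ 2 *
      (N%:R `^ (2 + eps) + \big[Num.max/0]_x (omega x)^-1))%:E)%E.
Proof.
move=> cross; apply: ge_ereal_sup => _ [f [_ mean0 ->]]; rewrite lee_fin.
have := sum_sqr_diff_energy_le N_gt1 f omega_gt0 d_gt1 cross.
have Nd_gt0 : 0 < N%:R ^+ d :> R by rewrite exprn_gt0 // ltr0n ltnW.
have sum0 : \sum_x f x = 0.
  move/eqP: mean0; rewrite /torus_mean mulf_eq0 invr_eq0 (gt_eqF Nd_gt0) /=.
  by move/eqP.
have -> : dirichlet_form omega f = (2 * N%:R ^+ d)^-1 * \sum_x site_energy omega f x by [].
(* Mean zero turns the double sum into [2 * N%:R ^+ d] times the sum of squares. *)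
rewrite sum_sqr_diff sum0 card_torus // natrX /torus_mean.
set D := \sum_x site_energy _ _ _; set S := \sum_x f x ^+ 2.
have D_ge0 : 0 <= D by apply: sumr_ge0 => x _; apply: site_energy_ge0.
set M := \big[_/_]_x _; have M_ge0 : 0 <= M by exact: bigmax_ge_id.
have : 0 <= N%:R `^ (2 + eps) + M by rewrite addr_ge0 ?powR_ge0.
move: (_ + M) => K K_ge0.
move: (N%:R ^+ d) Nd_gt0 => Nd Nd_gt0 le_S.
(* With [0^-1 = 0] the quotient is 0. No genuine case is hidden: [le_S] would then force [S = 0],
   hence f = 0. *)
have [->|D_neq0] := eqVneq D 0.
  by rewrite mulr0 invr0 mulr0 !mulr_ge0 // exprn_ge0.
have D_gt0 : 0 < D by rewrite lt_def D_neq0.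
rewrite ler_pdivrMr ?mulr_gt0 ?invr_gt0 ?mulr_gt0 // ler_pdivrMl //.
rewrite -(ler_pM2l (mulr_gt0 (ltr0Sn R 1) Nd_gt0)); apply: le_trans (le_trans le_S _).
  by rewrite expr0n /= subr0 mulrA.
rewrite le_eqVlt; apply/orP; left; apply/eqP.
by field; rewrite gt_eqF.
Qed.

(** Widths are natural numbers, so a nonempty set of them has a least element, and this bounds the
    infimum from below. *)
Lemma ell_min (tie : tie_rule d N) (eps : R) :
  ell tie eps omega = +oo%E \/
  exists2 L : nat, all_crossed tie eps omega L & (L%:R%:E <= ell tie eps omega)%E.
Proof.
pose P L := [/\ (1 <= L)%N, (3 * L < N)%N & all_crossed tie eps omega L].
have [[L PL]|noP] := pselect (exists L, P L).
  have exP : exists L, `[< P L >] by exists L; apply/asboolP.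
  right; case: (ex_minnP exP) => m /asboolP[_ _ cross] m_min; exists m => //.
  apply: le_ereal_inf_tmp => _ [k [k1 k2 k3 ->]].
  by rewrite lee_fin ler_nat m_min //; apply/asboolP.
left; rewrite -[RHS]ereal_inf0; congr ereal_inf; apply/seteqP; split=> // t.
by move=> [L [L1 L2 L3 _]]; apply: noP; exists L.
Qed.

End Gap.

(** As [t + 1] is at least 1, raising the exponent from 2 to [n] only increases the power. *)
Lemma expe_ge_sqr (R : realType) (n L : nat) (t : \bar R) : (1 < n)%N ->
  (L%:R%:E <= t)%E -> ((L%:R ^+ 2)%:E <= (t + 1) ^+ n)%E.
Proof.
case: n => [//|[//|n]] _; case: t => [t| |]; last by rewrite leeNy_eq.
  rewrite lee_fin => Lt; rewrite -EFinD -EFin_expe lee_fin.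
  have t0 : 0 <= t by apply: le_trans Lt.
  rewrite -(addn2 n) exprD; apply: (@le_trans _ _ ((t + 1) ^+ 2)).
    by rewrite lerXn2r ?nnegrE ?addr_ge0 // (le_trans Lt) // lerDl.
  by rewrite ler_peMl ?sqr_ge0 // exprn_ege1 // lerDr.
move=> _; have -> : (+oo + 1 = +oo :> \bar R)%E by [].
suff -> : (+oo ^+ n.+2 = +oo :> \bar R)%E by rewrite leey.
by elim: n => [|n IH]; rewrite expeS ?IH ?mulyy // expe2 mulyy.
Qed.

Theorem proposition3p20 (R : realType) (d : nat) (hd : (2 <= d)%N) :
  exists C : R, 0 < C /\
    forall (N : nat) (tie : tie_rule d N) (omega : torus d N -> R) (eps : R),
      (3 <= N)%N -> (forall x : torus d N, 0 < omega x) -> 0 < eps ->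
      (inverse_spectral_gap omega <=
        C%:E * (ell tie eps omega + 1) ^+ (2 * d) *
        (N%:R `^ (2 + eps) + \big[Num.max/0]_(x : torus d N) (omega x)^-1)%:E)%E.
Proof.
have C_gt0 : 0 < 6 * d%:R ^+ 3 :> R.
  by rewrite mulr_gt0 // exprn_gt0 // ltr0n ltnW.
exists (6 * d%:R ^+ 3); split=> // N tie omega eps hN omega_gt0 _.
have N_gt1 : (1 < N)%N by exact: ltnW.
(* Strict positivity matters: when [ell] is infinite, a factor 0 would make the right side 0 instead
   of [+oo]. *)
have K_gt0 : 0 < N%:R `^ (2 + eps) + \big[Num.max/0]_x (omega x)^-1.
  by rewrite ltr_pwDl ?powR_gt0 ?ltr0n 1?ltnW 1?ltnW // bigmax_ge_id.
have [ell_oo|[L cross L_le]] := ell_min omega tie eps.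
  have -> : ((ell tie eps omega + 1) ^+ (2 * d) = +oo)%E.
    rewrite ell_oo; have -> : (+oo + 1 = +oo :> \bar R)%E by [].
    case: (2 * d)%N (ltnW (leq_mul (leqnn 2) hd)) => [//|n] _.
    by elim: n => [//|n IH]; rewrite expeS IH mulyy.
  by rewrite gt0_muley ?lte_fin // gt0_mulye ?lte_fin // leey.
apply: le_trans (inverse_spectral_gap_le hd N_gt1 omega_gt0 cross) _.
rewrite 2!EFinM lee_wpmul2r ?lee_fin ?(ltW K_gt0) // lee_wpmul2l ?lee_fin ?(ltW C_gt0) //.
by apply: expe_ge_sqr => //; apply: leq_trans hd _; rewrite leq_pmull.
Qed.
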